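(* Let $v$ be a real-valued function that is smooth ($C^\infty$) in a neighborhood of a point $x_i\in\mathbb{R}$. For small $\Delta x>0$ consider the uniform grid of cells of width $\Delta x$ in which $x_i$ is a cell center, and for $j=0,1,2$ let $p_i^j$ be the polynomial of degree at most $2$ reconstructed from the cell averages $\bar v_{i-2+j},\bar v_{i-1+j},\bar v_{i+j}$ of $v$. Define the smoothness parameters $$\beta_j=\left(\int_{x_i-\frac{\Delta x}{2}}^{x_i+\frac{\Delta x}{2}}\sqrt{1+\left(\frac{d p_i^j}{dx}(x)\right)^2}\,dx\right)^2,\qquad j=0,1,2.$$ Then, as $\Delta x\to 0$, the $\beta_j$ satisfy $$\beta_j=D\left(1+O(\Delta x^2)\right),\qquad j=0,1,2,$$ for some quantity $D$ that is the same for $j=0,1,2$ (and may depend on $\Delta x$).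
   Context: The grid is uniform: $x_{i+m}=x_i+m\Delta x$ and $x_{i+m\pm\frac12}=x_{i+m}\pm\frac{\Delta x}{2}$ for $m\in\mathbb{Z}$, with cells $I_{i+m}=[x_{i+m-\frac12},x_{i+m+\frac12}]$. The cell averages of $v$ are $$\bar v_{i+m}=\frac{1}{\Delta x}\int_{x_{i+m-\frac12}}^{x_{i+m+\frac12}}v(z)\,dz .$$ For $j=0,1,2$, the third-order ENO reconstruction polynomial $p_i^j$ is the unique polynomial of degree at most $2$ whose averages over the three cells $I_{i-2+j}, I_{i-1+j}, I_{i+j}$ equal $\bar v_{i-2+j},\bar v_{i-1+j},\bar v_{i+j}$ respectively. Equivalently, it is the derivative of the polynomial of degree at most $3$ interpolating a primitive of $v$ at the four endpoints of these cells. Explicitly, with $s=(x-x_i)/\Delta x$, $$p_i^0(x)=\frac{-1+12s+12s^2}{24}\bar v_{i-2}+\frac{1-24s-12s^2}{12}\bar v_{i-1}+\frac{23+36s+12s^2}{24}\bar v_i,$$ $$p_i^1(x)=\frac{-1-12s+12s^2}{24}\bar v_{i-1}+\frac{13-12s^2}{12}\bar v_i+\frac{-1+12s+12s^2}{24}\bar v_{i+1},$$ $$p_i^2(x)=\frac{23-36s+12s^2}{24}\bar v_i+\frac{1+24s-12s^2}{12}\bar v_{i+1}+\frac{-1-12s+12s^2}{24}\bar v_{i+2}.$$ The quantity $\int_a^b\sqrt{1+P'(x)^2}\,dx$ is the length of the graph of $P$ over $[a,b]$, so $\beta_j$ is the squared curve length of $p_i^j$ over the cell $I_i$. The $O(\Delta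 x^2)$ terms may depend on $j$; the point $x_i$ and the function $v$ are held fixed as $\Delta x\to0$. *)

(* Defs.v *)
From Stdlib Require Import Reals Lra Lia ZArith.
From Coquelicot Require Import Coquelicot.
Open Scope R_scope.

(* The neighbourhood does not depend on the order of differentiation. *)
Definition smooth_near (v : R -> R) (x0 : R) : Prop :=
  locally x0 (fun x => forall n : nat, ex_derive_n v n x).

(* Grid of width h centred at xi; the cells are indexed by their offset
   m : Z from the cell I_i. *)
Definition grid_pt (xi h : R) (m : Z) : R := xi + IZR m * h.

Definition cell_avg (f : R -> R) (xi h : R) (m : Z) : R :=
  1 / h * RInt f (grid_pt xi h m - h / 2) (grid_pt xi h m + h / 2).

Definition poly_deg_le (n : nat) (p : R -> R) : Prop :=
  exists a : nat -> R, forall x, p x = sum_f_R0 (fun k => a k * x ^ k) n.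

(* Meaningful for j = 0, 1, 2; existence and uniqueness are
   eno_explicit_correct and eno_reconstruction_unique below. *)
Definition is_eno_reconstruction
    (v : R -> R) (xi h : R) (j : nat) (p : R -> R) : Prop :=
  poly_deg_le 2 p /\
  forall m : Z, (Z.of_nat j - 2 <= m <= Z.of_nat j)%Z ->
    cell_avg p xi h m = cell_avg v xi h m.

Definition curve_length (f : R -> R) (a b : R) : R :=
  RInt (fun x => sqrt (1 + (Derive f x) ^ 2)) a b.

Definition smoothness_parameter (p : R -> R) (xi h : R) : R :=
  (curve_length p (xi - h / 2) (xi + h / 2)) ^ 2.

Definition is_bigO (F : (R -> Prop) -> Prop) (f g : R -> R) : Prop :=
  exists C : R, F (fun h => Rabs (f h) <= C * Rabs (g h)).

Definition eno_explicit (v : R -> R) (xi h : R) (j : nat) (x : R) : R :=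
  let s := (x - xi) / h in
  let w := cell_avg v xi h in
  match j with
  | 0%nat => (-1 + 12 * s + 12 * s ^ 2) / 24 * w (-2)%Z
           + (1 - 24 * s - 12 * s ^ 2) / 12 * w (-1)%Z
           + (23 + 36 * s + 12 * s ^ 2) / 24 * w 0%Z
  | 1%nat => (-1 - 12 * s + 12 * s ^ 2) / 24 * w (-1)%Z
           + (13 - 12 * s ^ 2) / 12 * w 0%Z
           + (-1 + 12 * s + 12 * s ^ 2) / 24 * w 1%Z
  | _ => (23 - 36 * s + 12 * s ^ 2) / 24 * w 0%Z
       + (1 + 24 * s - 12 * s ^ 2) / 12 * w 1%Z
       + (-1 - 12 * s + 12 * s ^ 2) / 24 * w 2%Z
  end.

Lemma cell_avg_quadratic (p : R -> R) (A B C xi h : R) (m : Z) :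
  h <> 0 ->
  (forall x, p x = A + B * ((x - xi) / h) + C * ((x - xi) / h) ^ 2) ->
  cell_avg p xi h m = A + B * IZR m + C * (IZR m ^ 2 + 1 / 12).
Proof.
intros Hh Hp; unfold cell_avg.
set (F := fun x => A * x + B * ((x - xi) ^ 2 / (2 * h))
                   + C * ((x - xi) ^ 3 / (3 * h ^ 2))).
rewrite (is_RInt_unique _ _ _
  (F (grid_pt xi h m + h / 2) - F (grid_pt xi h m - h / 2))).
- unfold F, grid_pt; field; exact Hh.
- apply (is_RInt_derive F).
  + intros x _; unfold F; auto_derive; [easy | rewrite Hp; field; exact Hh].
  + intros x _.
    apply continuous_ext with
      (fun x => A + B * ((x - xi) / h) + C * ((x - xi) / h) ^ 2).
    * intros y; now rewrite Hp.
    * apply (ex_derive_continuous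
        (fun x => A + B * ((x - xi) / h) + C * ((x - xi) / h) ^ 2)).
      auto_derive; easy.
Qed.

Lemma poly_deg_le_2_scaled (p : R -> R) (xi h : R) :
  h <> 0 -> poly_deg_le 2 p <->
  exists A B C, forall x,
    p x = A + B * ((x - xi) / h) + C * ((x - xi) / h) ^ 2.
Proof.
intros Hh; split.
- intros [a Ha].
  exists (a 0%nat + a 1%nat * xi + a 2%nat * xi ^ 2),
         ((a 1%nat + 2 * a 2%nat * xi) * h), (a 2%nat * h ^ 2).
  intros x; rewrite Ha; simpl; field; exact Hh.
- intros (A & B & C & H).
  exists (fun k => match k with
    | 0%nat => A - B * xi / h + C * xi ^ 2 / h ^ 2
    | 1%nat => B / h - 2 * C * xi / h ^ 2
    | _ => C / h ^ 2 end).
  intros x; rewrite H; simpl; field; exact Hh.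
Qed.

Lemma eno_explicit_correct (v : R -> R) (xi h : R) (j : nat) :
  h <> 0 -> (j <= 2)%nat ->
  is_eno_reconstruction v xi h j (eno_explicit v xi h j).
Proof.
intros Hh Hj.
assert (Hq : forall A B C,
  (forall x, eno_explicit v xi h j x
             = A + B * ((x - xi) / h) + C * ((x - xi) / h) ^ 2) ->
  (forall m : Z, (Z.of_nat j - 2 <= m <= Z.of_nat j)%Z ->
     A + B * IZR m + C * (IZR m ^ 2 + 1 / 12) = cell_avg v xi h m) ->
  is_eno_reconstruction v xi h j (eno_explicit v xi h j)).
{ intros A B C H1 H2; split.
  - apply (poly_deg_le_2_scaled _ xi h Hh); now exists A, B, C.
  - intros m Hm; rewrite (cell_avg_quadratic _ A B C); auto. }
set (w := cell_avg v xi h) in *.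
destruct j as [|[|[|j]]]; [| | |lia].
- apply (Hq (- w (-2)%Z / 24 + w (-1)%Z / 12 + 23 * w 0%Z / 24)
            (w (-2)%Z / 2 - 2 * w (-1)%Z + 3 * w 0%Z / 2)
            (w (-2)%Z / 2 - w (-1)%Z + w 0%Z / 2)).
  + intros x; unfold eno_explicit; fold w; field; exact Hh.
  + intros m Hm.
    assert (E : (m = -2 \/ m = -1 \/ m = 0)%Z) by lia.
    destruct E as [-> | [-> | ->]]; field.
- apply (Hq (- w (-1)%Z / 24 + 13 * w 0%Z / 12 - w 1%Z / 24)
            (- w (-1)%Z / 2 + w 1%Z / 2)
            (w (-1)%Z / 2 - w 0%Z + w 1%Z / 2)).
  + intros x; unfold eno_explicit; fold w; field; exact Hh.
  + intros m Hm.
    assert (E : (m = -1 \/ m = 0 \/ m = 1)%Z) by lia.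
    destruct E as [-> | [-> | ->]]; field.
- apply (Hq (23 * w 0%Z / 24 + w 1%Z / 12 - w 2%Z / 24)
            (- 3 * w 0%Z / 2 + 2 * w 1%Z - w 2%Z / 2)
            (w 0%Z / 2 - w 1%Z + w 2%Z / 2)).
  + intros x; unfold eno_explicit; fold w; field; exact Hh.
  + intros m Hm.
    assert (E : (m = 0 \/ m = 1 \/ m = 2)%Z) by lia.
    destruct E as [-> | [-> | ->]]; field.
Qed.

Lemma eno_reconstruction_unique (v : R -> R) (xi h : R) (j : nat) (p q : R -> R) :
  h <> 0 ->
  is_eno_reconstruction v xi h j p -> is_eno_reconstruction v xi h j q ->
  forall x, p x = q x.
Proof.
intros Hh [Hp1 Hp2] [Hq1 Hq2] x.
apply (poly_deg_le_2_scaled _ xi h Hh) in Hp1, Hq1.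
destruct Hp1 as (A & B & C & Hp); destruct Hq1 as (A' & B' & C' & Hq).
assert (H : forall m : Z, (Z.of_nat j - 2 <= m <= Z.of_nat j)%Z ->
  A + B * IZR m + C * (IZR m ^ 2 + 1 / 12)
  = A' + B' * IZR m + C' * (IZR m ^ 2 + 1 / 12)).
{ intros m Hm.
  rewrite <- (cell_avg_quadratic p A B C xi h m Hh Hp).
  rewrite <- (cell_avg_quadratic q A' B' C' xi h m Hh Hq).
  now rewrite Hp2, Hq2. }
pose proof (H (Z.of_nat j - 2)%Z ltac:(lia)) as H0.
pose proof (H (Z.of_nat j - 1)%Z ltac:(lia)) as H1.
pose proof (H (Z.of_nat j) ltac:(lia)) as H2.
rewrite minus_IZR in H0, H1; set (t := IZR (Z.of_nat j)) in *.
assert (EC : C = C') by nra.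
subst C'.
assert (EB : B = B') by nra.
subst B'.
assert (EA : A = A') by nra.
now rewrite Hp, Hq, EA.
Qed.

(* Main.v *)
Require Import Defs.
From Stdlib Require Import Reals Lra Lia.
From Coquelicot Require Import Coquelicot.
Open Scope R_scope.

(** The common quantity [D] is the squared length of the graph of [v] itself
    over the central cell.

    The arc-length integrand is [1]-Lipschitz in the slope, so over a cell of
    width [h] the lengths of two graphs whose slopes differ by at most [K h^2]
    differ by at most [K h^3] ([curve_length_lipschitz]).  A graph over the
    cell is at least [h] long, hence the ratio of the two lengths is
    [1 + O(h^2)], and so is its square ([square_ratio_close]).

    What remains is that every reconstruction has slope [v' + O(h^2)] on the
    central cell ([eno_slope_error]).  Let [q] be the second Taylor polynomial
    of [v] at [xi]; then [v - q = O(h^3)] and [v' - q' = O(h^2)] on the stencil.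
    A quadratic is determined by its averages over three consecutive cells,
    so [p - q], whose averages are those of [v - q], has coefficients [O(h^3)]
    in the scaled variable [(x - xi) / h]
    ([quadratic_slope_coeffs_bound]).  Differentiation costs one factor [1 / h],
    which gives [p' - q' = O(h^2)] whichever of the three stencils is used. *)

(** * Taylor approximation near a point *)

(** One integration of a Taylor remainder, by the mean value inequality on the
    interval between [x0] and [x].  Losing the factor [1 / (n + 1)] is harmless
    for order estimates. *)
Lemma remainder_integrate (f g : R -> R) (x0 d M : R) (n : nat) :
  0 <= M -> f x0 = 0 ->
  (forall x, Rabs (x - x0) < d -> is_derive f x (g x)) ->
  (forall x, Rabs (x - x0) < d -> Rabs (g x) <= M * Rabs (x - x0) ^ n) ->
  forall x, Rabs (x - x0) < d -> Rabs (f x) <= M * Rabs (x - x0) ^ S n.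
Proof.
intros HM H0 Hd Hg x Hx.
replace (f x) with (f x - f x0) by (rewrite H0; ring).
replace (M * Rabs (x - x0) ^ S n) with (M * Rabs (x - x0) ^ n * Rabs (x - x0))
  by (simpl; ring).
apply bounded_variation with g; intros t Ht.
assert (Ht' : Rabs (t - x0) < d) by lra.
split; [now apply Hd|].
eapply Rle_trans; [now apply Hg|].
apply Rmult_le_compat_l; [exact HM|].
apply pow_incr; split; [apply Rabs_pos | exact Ht].
Qed.

Lemma smooth_near_quadratic_approx (v : R -> R) (x0 : R) :
  smooth_near v x0 ->
  exists b M d, 0 <= M /\ 0 < d /\ forall x, Rabs (x - x0) < d ->
    ex_derive v x /\ continuous (Derive v) x /\
    Rabs (v x - (v x0 + Derive v x0 * (x - x0) + b / 2 * (x - x0) ^ 2))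
      <= M * Rabs (x - x0) ^ 3 /\
    Rabs (Derive v x - (Derive v x0 + b * (x - x0))) <= M * Rabs (x - x0) ^ 2.
Proof.
intros hv.
assert (Hloc : forall (n : nat), locally x0 (fun x => ex_derive (Derive_n v n) x)).
{ intros n; unfold smooth_near in hv; revert hv; apply filter_imp; intros x Hx; exact (Hx (S n)). }
assert (Hb : locally x0 (fun x => Rabs (Derive_n v 3 x) <= Rabs (Derive_n v 3 x0) + 1)).
{ assert (Hc : continuous (Derive_n v 3) x0).
  { apply (ex_derive_continuous (V := R_NormedModule)).
    exact (locally_singleton _ _ (Hloc 3%nat)). }
  assert (Hc1 := proj1 (filterlim_locally _ _) Hc (mkposreal 1 Rlt_0_1)).
  revert Hc1; apply filter_imp; intros x Hx.
  assert (Hx' : Rabs (Derive_n v 3 x - Derive_n v 3 x0) < 1) by exact Hx.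
  pose proof (Rabs_triang_inv (Derive_n v 3 x) (Derive_n v 3 x0)); lra. }
destruct (filter_and _ _ (Hloc 0%nat) (filter_and _ _ (Hloc 1%nat)
  (filter_and _ _ (Hloc 2%nat) Hb))) as [d Hd].
set (M := Rabs (Derive_n v 3 x0) + 1) in *.
assert (HM : 0 <= M) by (unfold M; pose proof (Rabs_pos (Derive_n v 3 x0)); lra).
set (b := Derive_n v 2 x0).
assert (Hball : forall x, Rabs (x - x0) < d ->
  ex_derive v x /\ ex_derive (Derive v) x /\ ex_derive (Derive_n v 2) x /\
  Rabs (Derive_n v 3 x) <= M) by (intros x Hx; exact (Hd x Hx)).
assert (R2 : forall x, Rabs (x - x0) < d ->
  Rabs (Derive_n v 2 x - b) <= M * Rabs (x - x0) ^ 1).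
{ apply (remainder_integrate _ (Derive_n v 3)); [exact HM | unfold b; ring | |].
  - intros x Hx; destruct (Hball x Hx) as (_ & _ & H & _).
    auto_derive; [exact H | simpl; ring].
  - intros x Hx; destruct (Hball x Hx) as (_ & _ & _ & H); simpl in *; lra. }
assert (R1 : forall x, Rabs (x - x0) < d ->
  Rabs (Derive v x - (Derive v x0 + b * (x - x0))) <= M * Rabs (x - x0) ^ 2).
{ apply (remainder_integrate _ (fun x => Derive_n v 2 x - b));
    [exact HM | ring | | exact R2].
  intros x Hx; destruct (Hball x Hx) as (_ & H & _).
  auto_derive; [exact H|].
  change (Derive (fun y => Derive v y) x) with (Derive_n v 2 x); ring. }
exists b, M, d; split; [exact HM|]; split; [apply cond_pos|].
assert (R0 : forall x, Rabs (x - x0) < d ->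
  Rabs (v x - (v x0 + Derive v x0 * (x - x0) + b / 2 * (x - x0) ^ 2))
    <= M * Rabs (x - x0) ^ 3).
{ apply (remainder_integrate _
    (fun x => Derive v x - (Derive v x0 + b * (x - x0))));
    [exact HM | field | | exact R1].
  intros x Hx; destruct (Hball x Hx) as (H & _).
  auto_derive; [exact H |].
  change (Derive (fun x1 : R => v x1)) with (Derive v); field. }
intros x Hx; destruct (Hball x Hx) as (H1 & H2 & _).
split; [exact H1|]; split; [|split; [now apply R0 | now apply R1]].
now apply (ex_derive_continuous (V := R_NormedModule)).
Qed.

(** * Cell averages *)

Lemma cell_avg_close (f g : R -> R) (xi h E : R) (m : Z) :
  0 < h ->
  (forall x, Rabs (x - grid_pt xi h m) <= h / 2 ->
     continuous f x /\ continuous g x /\ Rabs (f x - g x) <= E) ->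
  Rabs (cell_avg f xi h m - cell_avg g xi h m) <= E.
Proof.
intros Hh H; unfold cell_avg; set (c := grid_pt xi h m) in *.
assert (Hin : forall x, c - h / 2 <= x <= c + h / 2 -> Rabs (x - c) <= h / 2)
  by (intros x Hx; apply Rabs_le; lra).
assert (Hf : ex_RInt f (c - h / 2) (c + h / 2)).
{ apply (ex_RInt_continuous (V := R_CompleteNormedModule)); intros x Hx.
  rewrite Rmin_left, Rmax_right in Hx by lra; now apply H, Hin. }
assert (Hg : ex_RInt g (c - h / 2) (c + h / 2)).
{ apply (ex_RInt_continuous (V := R_CompleteNormedModule)); intros x Hx.
  rewrite Rmin_left, Rmax_right in Hx by lra; now apply H, Hin. }
rewrite <- Rmult_minus_distr_l, Rabs_mult.
rewrite (Rabs_pos_eq (1 / h)) by (apply Rlt_le, Rdiv_lt_0_compat; lra).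
assert (HI : Rabs (RInt f (c - h / 2) (c + h / 2) - RInt g (c - h / 2) (c + h / 2))
             <= (c + h / 2 - (c - h / 2)) * E).
{ replace (RInt f _ _ - RInt g _ _)
    with (RInt (fun x => minus (f x) (g x)) (c - h / 2) (c + h / 2))
    by exact (RInt_minus f g _ _ Hf Hg).
  apply abs_RInt_le_const; [lra | now apply (ex_RInt_minus (V := R_NormedModule)) |].
  intros x Hx; now apply H, Hin. }
replace E with (1 / h * ((c + h / 2 - (c - h / 2)) * E)) by (field; lra).
apply Rmult_le_compat_l; [apply Rlt_le, Rdiv_lt_0_compat; lra | exact HI].
Qed.

(** [A + B t + C (t^2 + 1/12)] is the average over the cell of offset [t] of
    the quadratic with coefficients [A, B, C] in the scaled variable
    [s = (x - xi) / h].  The second difference of the three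
    averages is [2 C], and the central first difference is [B + 2 k C]. *)
Lemma quadratic_slope_coeffs_bound (A B C k E : R) :
  Rabs k <= 1 ->
  Rabs (A + B * (k - 1) + C * ((k - 1) ^ 2 + 1 / 12)) <= E ->
  Rabs (A + B * k + C * (k ^ 2 + 1 / 12)) <= E ->
  Rabs (A + B * (k + 1) + C * ((k + 1) ^ 2 + 1 / 12)) <= E ->
  Rabs B <= 5 * E /\ Rabs C <= 2 * E.
Proof.
intros Hk H0 H1 H2.
apply Rabs_le_between in H0, H1, H2.
assert (HC : Rabs C <= 2 * E) by (apply Rabs_le; lra).
split; [|exact HC].
set (S := B + 2 * (k * C)).
assert (HS : Rabs S <= E) by (apply Rabs_le; unfold S; lra).
assert (HkC : Rabs (k * C) <= 2 * E).
{ rewrite Rabs_mult; pose proof (Rabs_pos k); pose proof (Rabs_pos C); nra. }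
apply Rabs_le_between in HS, HkC.
apply Rabs_le; unfold S in HS; lra.
Qed.

(** * Slope of the reconstructions *)

Lemma poly_deg_le_2_derive (p : R -> R) :
  poly_deg_le 2 p -> exists a b, forall x, Derive p x = a + b * x.
Proof.
intros [a Ha]; exists (a 1%nat), (2 * a 2%nat); intros x.
apply is_derive_unique.
apply is_derive_ext with (fun x => a 0%nat + a 1%nat * x + a 2%nat * x ^ 2).
- intros t; rewrite Ha; simpl; ring.
- auto_derive; [easy | ring].
Qed.

(** The averages of the Taylor remainder over the stencil are at most
    [M (3 h)^3 = 27 M h^3], because the stencil stays within [5 h / 2] of [xi].
    On the central cell [|2 s| <= 1], so the slope of [p - q] is at most
    [(5 + 2) * 27 M h^3 / h = 189 M h^2]. *)
Lemma eno_slope_error (v : R -> R) (xi h a b M : R) (j : nat) (p : R -> R) :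
  0 < h -> 0 <= M -> (j <= 2)%nat ->
  is_eno_reconstruction v xi h j p ->
  (forall x, Rabs (x - xi) <= 3 * h ->
     continuous v x /\
     Rabs (v x - (v xi + a * (x - xi) + b / 2 * (x - xi) ^ 2))
       <= M * Rabs (x - xi) ^ 3) ->
  forall x, Rabs (x - xi) <= h / 2 ->
    Rabs (Derive p x - (a + b * (x - xi))) <= 189 * M * h ^ 2.
Proof.
intros Hh HM Hj [Hdeg Havg] Hv x Hx.
set (q := fun x => v xi + a * (x - xi) + b / 2 * (x - xi) ^ 2).
assert (Hh0 : h <> 0) by lra.
apply (poly_deg_le_2_scaled p xi h Hh0) in Hdeg.
destruct Hdeg as (A & B & C & Hp).
set (E := M * (3 * h) ^ 3).
assert (Hm : forall m : Z, (Z.of_nat j - 2 <= m <= Z.of_nat j)%Z ->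
  Rabs ((A - v xi) + (B - a * h) * IZR m
        + (C - b / 2 * h ^ 2) * (IZR m ^ 2 + 1 / 12)) <= E).
{ intros m Hm.
  assert (Hm2 : -2 <= IZR m <= 2) by (split; apply IZR_le; lia).
  replace (_ + _ + _) with (cell_avg v xi h m - cell_avg q xi h m).
  - apply cell_avg_close; [exact Hh|]; intros y Hy.
    assert (Hy3 : Rabs (y - xi) <= 3 * h).
    { unfold grid_pt in Hy; apply Rabs_le_between in Hy; apply Rabs_le; nra. }
    destruct (Hv y Hy3) as [Hc Hr]; split; [exact Hc|]; split.
    + apply (ex_derive_continuous (V := R_NormedModule)).
      unfold q; auto_derive; easy.
    + eapply Rle_trans; [exact Hr|]; unfold E.
      apply Rmult_le_compat_l; [exact HM|].
      apply pow_incr; split; [apply Rabs_pos | exact Hy3].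
  - rewrite <- Havg by exact Hm.
    rewrite (cell_avg_quadratic p A B C) by auto.
    rewrite (cell_avg_quadratic q (v xi) (a * h) (b / 2 * h ^ 2));
      [ring | exact Hh0 | intros y; unfold q; field; exact Hh0]. }
(* The stencil is centred at the offset j - 1, which lies in {-1, 0, 1}. *)
set (k := IZR (Z.of_nat j - 1)).
assert (Hk1 : -1 <= k <= 1) by (split; apply IZR_le; lia).
assert (Hk : Rabs k <= 1) by (apply Rabs_le; lra).
pose proof (Hm (Z.of_nat j - 1 - 1)%Z ltac:(lia)) as H0.
pose proof (Hm (Z.of_nat j - 1)%Z ltac:(lia)) as H1.
pose proof (Hm (Z.of_nat j - 1 + 1)%Z ltac:(lia)) as H2.
rewrite (minus_IZR (Z.of_nat j - 1) 1) in H0.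
rewrite (plus_IZR (Z.of_nat j - 1) 1) in H2.
fold k in H0, H1, H2.
destruct (quadratic_slope_coeffs_bound _ _ _ k E Hk H0 H1 H2) as [HB HC].
set (s := (x - xi) / h).
assert (Hs : Rabs (2 * s) <= 1).
{ replace (2 * s) with (2 / h * (x - xi)) by (unfold s; field; exact Hh0).
  rewrite Rabs_mult, Rabs_pos_eq by (apply Rlt_le, Rdiv_lt_0_compat; lra).
  replace 1 with (2 / h * (h / 2)) by (field; exact Hh0).
  apply Rmult_le_compat_l; [apply Rlt_le, Rdiv_lt_0_compat; lra | exact Hx]. }
replace (Derive p x - (a + b * (x - xi)))
  with (1 / h * ((B - a * h) + (C - b / 2 * h ^ 2) * (2 * s))).
- rewrite Rabs_mult, (Rabs_pos_eq (1 / h))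
    by (apply Rlt_le, Rdiv_lt_0_compat; lra).
  replace (189 * M * h ^ 2) with (1 / h * (7 * E))
    by (unfold E; field; exact Hh0).
  apply Rmult_le_compat_l; [apply Rlt_le, Rdiv_lt_0_compat; lra|].
  eapply Rle_trans; [apply Rabs_triang|].
  rewrite Rabs_mult.
  pose proof (Rabs_pos (C - b / 2 * h ^ 2)); pose proof (Rabs_pos (2 * s)); nra.
- replace (Derive p x) with (B / h + 2 * C * (x - xi) / h ^ 2).
  + unfold s; field; exact Hh0.
  + symmetry; apply is_derive_unique.
    apply is_derive_ext
      with (fun x => A + B * ((x - xi) / h) + C * ((x - xi) / h) ^ 2).
    * intros t; now rewrite Hp.
    * auto_derive; [easy | field; exact Hh0].
Qed.

(** * Lengths of graphs *)

(** [sqrt (1 + y^2)] is the distance from [(1, y)] to the origin, so this is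
    the reverse triangle inequality. *)
Lemma arc_element_lipschitz (y z : R) :
  Rabs (sqrt (1 + y ^ 2) - sqrt (1 + z ^ 2)) <= Rabs (y - z).
Proof.
assert (Hup : forall u w, Rabs u <= sqrt (1 + u ^ 2) /\ 0 <= 1 + w ^ 2).
{ intros u w; split; [|nra].
  rewrite <- sqrt_Rsqr_abs; apply sqrt_le_1_alt; unfold Rsqr; nra. }
set (p := sqrt (1 + y ^ 2)); set (q := sqrt (1 + z ^ 2)).
assert (Hp : p * p = 1 + y ^ 2) by (apply sqrt_sqrt, (Hup 0 y)).
assert (Hq : q * q = 1 + z ^ 2) by (apply sqrt_sqrt, (Hup 0 z)).
assert (Hp0 : 0 < p) by (apply sqrt_lt_R0; nra).
assert (Hq0 : 0 < q) by (apply sqrt_lt_R0; nra).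
destruct (Hup y 0) as [Hyp _]; destruct (Hup z 0) as [Hzq _].
fold p in Hyp; fold q in Hzq.
apply Rmult_le_reg_r with (p + q); [lra|].
rewrite <- (Rabs_pos_eq (p + q)) at 1 by lra.
rewrite <- Rabs_mult.
replace ((p - q) * (p + q)) with ((y - z) * (y + z)) by lra.
rewrite Rabs_mult.
apply Rmult_le_compat_l; [apply Rabs_pos|].
eapply Rle_trans; [apply Rabs_triang | lra].
Qed.

Lemma ex_RInt_arc_element (f : R -> R) (a b : R) :
  a <= b -> (forall x, a <= x <= b -> continuous (Derive f) x) ->
  ex_RInt (fun x => sqrt (1 + Derive f x ^ 2)) a b.
Proof.
intros Hab Hc; apply (ex_RInt_continuous (V := R_CompleteNormedModule)).
intros x Hx; rewrite Rmin_left, Rmax_right in Hx by lra.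
apply (continuous_comp (Derive f) (fun y => sqrt (1 + y ^ 2))); [now apply Hc|].
apply (ex_derive_continuous (V := R_NormedModule)).
auto_derive; nra.
Qed.

Lemma curve_length_lipschitz (f g : R -> R) (a b K : R) :
  a <= b ->
  (forall x, a <= x <= b -> continuous (Derive f) x) ->
  (forall x, a <= x <= b -> continuous (Derive g) x) ->
  (forall x, a <= x <= b -> Rabs (Derive f x - Derive g x) <= K) ->
  Rabs (curve_length f a b - curve_length g a b) <= (b - a) * K.
Proof.
intros Hab Hf Hg H; unfold curve_length.
pose proof (ex_RInt_arc_element f a b Hab Hf) as If.
pose proof (ex_RInt_arc_element g a b Hab Hg) as Ig.
replace (RInt _ a b - RInt _ a b)
  with (RInt (fun x => minus (sqrt (1 + Derive f x ^ 2))
                             (sqrt (1 + Derive g x ^ 2))) a b)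
  by exact (RInt_minus _ _ _ _ If Ig).
apply abs_RInt_le_const;
  [exact Hab | now apply (ex_RInt_minus (V := R_NormedModule)) |].
intros x Hx; eapply Rle_trans; [apply arc_element_lipschitz | now apply H].
Qed.

Lemma curve_length_ge (f : R -> R) (a b : R) :
  a <= b -> (forall x, a <= x <= b -> continuous (Derive f) x) ->
  b - a <= curve_length f a b.
Proof.
intros Hab Hc; unfold curve_length.
replace (b - a) with (RInt (fun _ => 1) a b)
  by (rewrite RInt_const; unfold scal; simpl; unfold mult; simpl; ring).
apply RInt_le; [exact Hab | apply ex_RInt_const | now apply ex_RInt_arc_element |].
intros x _; rewrite <- sqrt_1 at 1; apply sqrt_le_1_alt; nra.
Qed.

(** With the relative error [r = (l - L) / L], the left-hand side is
    [r (2 + r)], and [|r| <= K h^2 <= K]. *)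
Lemma square_ratio_close (l L h K : R) :
  0 < h <= 1 -> 0 <= K -> h <= L -> Rabs (l - L) <= h * (K * h ^ 2) ->
  Rabs (l ^ 2 / L ^ 2 - 1) <= K * (2 + K) * h ^ 2.
Proof.
intros Hh HK HL Hl.
set (r := (l - L) / L).
assert (Hr : Rabs r <= K * h ^ 2).
{ unfold r, Rdiv; rewrite Rabs_mult, (Rabs_pos_eq (/ L))
    by (apply Rlt_le, Rinv_0_lt_compat; lra).
  apply Rmult_le_reg_r with L; [lra|].
  rewrite Rmult_assoc, Rinv_l, Rmult_1_r by lra.
  eapply Rle_trans; [exact Hl|].
  rewrite (Rmult_comm h); apply Rmult_le_compat_l; [nra | exact HL]. }
replace (l ^ 2 / L ^ 2 - 1) with (r * (2 + r)) by (unfold r; field; lra).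
assert (HK2 : K * h ^ 2 <= K * 1) by (apply Rmult_le_compat_l; nra).
assert (HrK : Rabs (2 + r) <= 2 + K).
{ eapply Rle_trans; [apply Rabs_triang|].
  rewrite (Rabs_pos_eq 2) by lra; lra. }
rewrite Rabs_mult.
replace (K * (2 + K) * h ^ 2) with (K * h ^ 2 * (2 + K)) by ring.
apply Rmult_le_compat; [apply Rabs_pos | apply Rabs_pos | exact Hr | exact HrK].
Qed.

(** * The smoothness parameters *)

Lemma at_right_0_lt (d : R) : 0 < d -> at_right 0 (fun h => 0 < h < d).
Proof.
intros Hd; exists (mkposreal d Hd); intros h Hb Hh.
assert (H : Rabs (h - 0) < d) by exact Hb.
apply Rabs_lt_between in H; lra.
Qed.

Theorem theorem4p1 (v : R -> R) (xi : R) (p : nat -> R -> R -> R)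
  (hv : smooth_near v xi)
  (hp : forall j : nat, (j <= 2)%nat ->
     at_right 0 (fun h => is_eno_reconstruction v xi h j (p j h))) :
  exists D : R -> R,
    forall j : nat, (j <= 2)%nat ->
      exists e : R -> R,
        is_bigO (at_right 0) e (fun h => h ^ 2) /\
        at_right 0 (fun h =>
          smoothness_parameter (p j h) xi h = D h * (1 + e h)).
Proof.
destruct (smooth_near_quadratic_approx v xi hv) as (b & M & d & HM & Hd & Hv).
set (D := smoothness_parameter v xi).
exists D; intros j Hj.
exists (fun h => smoothness_parameter (p j h) xi h / D h - 1).
set (r := Rmin 1 (d / 3)).
assert (Hr : 0 < r) by (apply Rmin_glb_lt; lra).
assert (Hr1 : r <= 1) by apply Rmin_l.
assert (Hrd : r <= d / 3) by apply Rmin_r.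
assert (Hdv : forall h, 0 < h < r ->
  forall x, xi - h / 2 <= x <= xi + h / 2 -> continuous (Derive v) x).
{ intros h Hh x Hx; apply Hv, Rabs_lt_between; lra. }
split.
(* Slopes differ by at most 190 M h^2: 189 from p' - q', 1 from q' - v'. *)
- exists (190 * M * (2 + 190 * M)).
  generalize (filter_and _ _ (hp j Hj) (at_right_0_lt r Hr)).
  apply filter_imp; intros h [Hrec Hh].
  rewrite (Rabs_pos_eq (h ^ 2)) by nra.
  apply square_ratio_close; [lra | lra | |].
  + replace h with (xi + h / 2 - (xi - h / 2)) at 1 by field.
    apply curve_length_ge; [lra | now apply Hdv].
  + replace (h * (190 * M * h ^ 2))
      with ((xi + h / 2 - (xi - h / 2)) * (190 * M * h ^ 2)) by field.
    apply curve_length_lipschitz; [lra | | now apply Hdv |].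
    * intros x _.
      destruct (poly_deg_le_2_derive _ (proj1 Hrec)) as (c0 & c1 & Hc).
      apply continuous_ext with (fun x => c0 + c1 * x); [now intros y; rewrite Hc|].
      apply (ex_derive_continuous (V := R_NormedModule)); auto_derive; easy.
    * intros x Hx.
      assert (Hxh : Rabs (x - xi) <= h / 2) by (apply Rabs_le; lra).
      assert (Hp : Rabs (Derive (p j h) x - (Derive v xi + b * (x - xi)))
                   <= 189 * M * h ^ 2).
      { apply (eno_slope_error v xi h _ _ _ j); auto; [lra|].
        intros y Hy; destruct (Hv y ltac:(lra)) as (H1 & _ & H2 & _).
        split; [|exact H2].
        now apply (ex_derive_continuous (V := R_NormedModule)). }
      destruct (Hv x ltac:(lra)) as (_ & _ & _ & Hvx).
      assert (Hsq : M * Rabs (x - xi) ^ 2 <= M * h ^ 2).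
      { apply Rmult_le_compat_l; [exact HM|].
        apply pow_incr; split; [apply Rabs_pos | lra]. }
      apply Rabs_le_between in Hp, Hvx; apply Rabs_le; lra.
- generalize (at_right_0_lt r Hr); apply filter_imp; intros h Hh.
  assert (HL : h <= curve_length v (xi - h / 2) (xi + h / 2)).
  { replace h with (xi + h / 2 - (xi - h / 2)) at 1 by field.
    apply curve_length_ge; [lra | now apply Hdv]. }
  assert (HD : 0 < D h) by (unfold D, smoothness_parameter; nra).
  field; lra.
Qed.
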